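(* Let $f(w):=w^p$ for $w\ge 0$, for some $0<p<1$. For all $\delta>0$, if $g$ is the $\delta$-smoothing of $f$, then $g(w)\le f(w)$ for all $w\ge 0$.
   Context: For $f$ on $[0,+\infty)$ with $f(0)=0$ and $f$ twice differentiable at $\delta>0$, the $\delta$-smoothing of $f$ is the function $g$ on $[0,+\infty)$ defined by $g(w)=g_1w+\frac12 g_2w^2+\frac16 g_3w^3$ for $0\le w\le\delta$ and $g(w)=f(w)$ for $w>\delta$, where $$g_1=\frac{3f(\delta)}{\delta}-2f'(\delta)+\frac{\delta f''(\delta)}{2},\quad g_2=-\frac{6f(\delta)}{\delta^2}+\frac{6f'(\delta)}{\delta}-2f''(\delta),\quad g_3=\frac{6f(\delta)}{\delta^3}-\frac{6f'(\delta)}{\delta^2}+\frac{3f''(\delta)}{\delta}.$$ *)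

(* Defs.v *)
From mathcomp Require Import all_boot all_order all_algebra.
From mathcomp Require Import all_classical all_reals all_analysis.
Import Order.TTheory GRing.Theory Num.Theory.
Import numFieldNormedType.Exports.

Set Implicit Arguments.
Unset Strict Implicit.
Unset Printing Implicit Defensive.

Local Open Scope ring_scope.
Local Open Scope classical_set_scope.

(* A function on [0, +oo[ is represented by a total function R -> R, only the
   values of which at nonnegative points are ever constrained; since delta > 0,
   the derivatives at delta do not depend on the values at negative points. *)
Section Smoothing.
Variable R : realType.
Implicit Types (f g : R -> R) (delta w : R).

Definition smoothable f delta : Prop :=
  [/\ 0 < delta, f 0 = 0,
      \forall x \near delta, derivable f x 1 &
      derivable f^`()%classic delta 1].

Definition smoothing1 f delta : R :=
  3 * f delta / delta - 2 * f^`()%classic delta + delta * f^`(2)%classic delta / 2.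

Definition smoothing2 f delta : R :=
  - (6 * f delta / delta ^+ 2) + 6 * f^`()%classic delta / delta - 2 * f^`(2)%classic delta.

Definition smoothing3 f delta : R :=
  6 * f delta / delta ^+ 3 - 6 * f^`()%classic delta / delta ^+ 2
  + 3 * f^`(2)%classic delta / delta.

(* The derivatives are total operators, so this is meaningful only under
   [smoothable f delta]; see [smoothable_powR] for the power functions. *)
Definition is_smoothing f delta g : Prop :=
  forall w, 0 <= w ->
    g w = if w <= delta then
            smoothing1 f delta * w + 1 / 2 * smoothing2 f delta * w ^+ 2
            + 1 / 6 * smoothing3 f delta * w ^+ 3
          else f w.

Lemma smoothable_powR (p delta : R) f :
  (forall w, 0 <= w -> f w = w `^ p) -> 0 < p -> 0 < delta ->
  smoothable f delta.
Proof.
move=> fE p0 d0.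
have near_gt0 (x : R) : 0 < x -> \forall y \near x, 0 < y by exact: lt_nbhsr.
have near_f (x : R) : 0 < x -> \forall y \near x, y `^ p = f y.
  by move=> /near_gt0; apply: filterS => y /ltW /fE ->.
split => //; first by rewrite fE// powR0 ?gt_eqF.
  apply: filterS (near_gt0 _ d0) => x x0.
  apply: (near_eq_derivable (near_f _ x0)).
  by apply: derivable_powR; rewrite in_itv/= andbT.
apply: (@near_eq_derivable _ _ _ (fun x : R => p * x `^ (p - 1))).
  apply: filterS (near_gt0 _ d0) => x x0.
  rewrite derive1E -(near_eq_derive _ (near_f _ x0)) -derive1E.
  by rewrite powR_derive1// in_itv/= andbT.
apply: derivableM; first exact: derivable_cst.
by apply: derivable_powR; rewrite in_itv/= andbT.
Qed.

End Smoothing.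

(* Main.v *)
Require Import Defs.
From mathcomp Require Import all_boot all_order all_algebra.
From mathcomp Require Import all_classical all_reals all_analysis.
From mathcomp Require Import ring lra.
Import Order.TTheory GRing.Theory Num.Theory.
Import numFieldNormedType.Exports.
Local Open Scope ring_scope.

(** On [0, delta] the smoothing is a cubic without constant term that agrees
    with the power function [w `^ p] to second order at [delta].  Put
    [t := w / delta] and [s := 1 - p].  Dividing by [w] turns the
    cubic into a quadratic that agrees to second order at [t = 1] with
    [t `^ (- s)] times the constant [delta `^ p / delta]; so it is that constant
    times the Taylor polynomial of [t `^ (- s)] of degree 2 at 1
    ([smoothing_powRE]).  As [s >= 0], the third
    derivative of [t `^ (- s)] is nonpositive, while [(t - 1) ^+ 3 <= 0] for
    [t <= 1]: the remainder is nonnegative, so the Taylor polynomial lies below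
    the function ([taylor2_powR_le1]).  Multiplying back by [w] gives the
    claim. *)

(** Multiplied by [t `^ s], the Taylor polynomial of [t `^ (- s)] at 1 has only
    the truncation term left in its derivative: a single first derivative
    suffices to control the remainder. *)
Lemma is_derive_powR_taylor2 (R : realType) (s t : R) : 0 < t ->
  is_derive t 1
    (fun x : R => x `^ s * (1 + s * (1 - x) + s * (s + 1) / 2 * (1 - x) ^+ 2))
    (t `^ (s - 1) * (s * (s + 1) * (s + 2) / 2 * (1 - t) ^+ 2)).
Proof.
move=> t0.
have ds := is_derive1_powR s t0.
have dq : is_derive t 1
    (fun x : R => 1 + s * (1 - x) + s * (s + 1) / 2 * (1 - x) ^+ 2)
    (- s - s * (s + 1) * (1 - t)).
  by apply: is_derive_eq; rewrite /GRing.scale /=; field.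
have tsE : t `^ s = t * t `^ (s - 1).
  by rewrite -[X in X * _]powRr1 ?ltW// -powRD ?(gt_eqF t0) ?implybT// addrC subrK.
apply: is_derive_eq; rewrite /GRing.scale /= tsE.
by field.
Qed.

Lemma taylor2_powR_le1 (R : realType) (s t : R) : 0 <= s -> 0 < t -> t <= 1 ->
  t `^ s * (1 + s * (1 - t) + s * (s + 1) / 2 * (1 - t) ^+ 2) <= 1.
Proof.
move=> s0 t0 t1.
pose phi x := x `^ s * (1 + s * (1 - x) + s * (s + 1) / 2 * (1 - x) ^+ 2).
have phi1 : phi 1 = 1 by rewrite /phi powR1 subrr; ring.
have dphi (x : R) : x \in `]0, 2[ -> is_derive x 1 phi
    (x `^ (s - 1) * (s * (s + 1) * (s + 2) / 2 * (1 - x) ^+ 2)).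
  by rewrite in_itv/= => /andP[x0 _]; exact: is_derive_powR_taylor2.
rewrite -/(phi t) -phi1.
(* the derivative keeps its sign past 1, so an open interval around 1 serves *)
apply: (@ger0_derive1_le_oo R phi 0 2) => //.
- by move=> x /dphi [].
- move=> x /dphi dx; rewrite derive1E derive_val.
  rewrite mulr_ge0 ?powR_ge0// mulr_ge0 ?sqr_ge0// divr_ge0// !mulr_ge0//; lra.
- move=> x; rewrite inE/= => /dphi [dx _].
  exact/differentiable_continuous/derivable1_diffP.
- by rewrite in_itv/=; lra.
- by rewrite in_itv/=; lra.
Qed.

Lemma near_powR (R : realType) (p x : R) (f : R -> R) :
  (forall w, 0 <= w -> f w = w `^ p) -> 0 < x -> \forall y \near x, f y = y `^ p.
Proof.
move=> fE x0; have : \forall y \near x, 0 < y by exact: lt_nbhsr.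
by apply: filterS => y /ltW /fE.
Qed.

Lemma derive1_powR_near (R : realType) (p x : R) (f : R -> R) :
  (forall w, 0 <= w -> f w = w `^ p) -> 0 < x ->
  f^`()%classic x = p * x `^ (p - 1).
Proof.
move=> fE x0; rewrite derive1E (near_eq_derive _ (@near_powR R _ _ _ fE x0)).
by rewrite (@derive_val _ _ _ _ _ _ _ (is_derive1_powR p x0)).
Qed.

Lemma derive2_powR_near (R : realType) (p x : R) (f : R -> R) :
  (forall w, 0 <= w -> f w = w `^ p) -> 0 < x ->
  f^`(2)%classic x = p * (p - 1) * x `^ (p - 2).
Proof.
move=> fE x0; rewrite derive1nS derive1n1 derive1E.
have near_df : \forall y \near x, f^`()%classic y = p * y `^ (p - 1).
  have : \forall y \near x, 0 < y by exact: lt_nbhsr.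
  by apply: filterS => y; exact: derive1_powR_near.
rewrite (near_eq_derive _ near_df).
have ds := is_derive1_powR (p - 1) x0.
rewrite deriveM// !derive_val /GRing.scale /= mulr0 addr0 mulrA.
by congr (_ * _ `^ _); ring.
Qed.

Lemma smoothing_powRE (R : realType) (p delta w : R) (f : R -> R) :
  (forall w, 0 <= w -> f w = w `^ p) -> 0 < delta ->
  let s := 1 - p in let t := w / delta in
  smoothing1 f delta * w + 1 / 2 * smoothing2 f delta * w ^+ 2
    + 1 / 6 * smoothing3 f delta * w ^+ 3
  = delta `^ p * (t * (1 + s * (1 - t) + s * (s + 1) / 2 * (1 - t) ^+ 2)).
Proof.
move=> fE d0 s t; have dn0 : delta != 0 by rewrite gt_eqF.
have powR_pred n : delta `^ (p - n%:R) = delta `^ p / delta ^+ n.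
  by rewrite powRB ?dn0 ?implybT// powR_mulrn// ltW.
rewrite /smoothing1 /smoothing2 /smoothing3 (derive2_powR_near _ _ _ _ fE)//.
rewrite (derive1_powR_near _ _ _ _ fE)// fE ?ltW// (powR_pred 1) (powR_pred 2) /s /t.
by field.
Qed.

Theorem corollary3p3 (R : realType) (p : R) (hp0 : 0 < p) (hp1 : p < 1)
    (f : R -> R) (hf : forall w : R, 0 <= w -> f w = w `^ p)
    (delta : R) (hdelta : 0 < delta)
    (g : R -> R) (hg : is_smoothing f delta g) :
  forall w : R, 0 <= w -> g w <= f w.
Proof.
move=> w w0; rewrite hg//; case: ifPn => // wd.
rewrite (smoothing_powRE _ _ _ _ _ hf)// hf//.
have [->|wn0] := eqVneq w 0; first by rewrite !mul0r mulr0 powR_ge0.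
set t := w / delta.
have t0 : 0 < t by rewrite divr_gt0// lt0r wn0.
have t1 : t <= 1 by rewrite ler_pdivrMr// mul1r.
have -> : w `^ p = delta `^ p * t `^ p.
  by rewrite -powRM ?ltW// mulrC divfK// gt_eqF.
rewrite ler_wpM2l ?powR_ge0//.
have tE : t = t `^ p * t `^ (1 - p).
  by rewrite -powRD ?(gt_eqF t0) ?implybT// subrKC powRr1// ltW.
rewrite [X in X * _]tE -mulrA -[leRHS]mulr1 ler_wpM2l ?powR_ge0//.
by apply: taylor2_powR_le1 => //; rewrite subr_ge0 ltW.
Qed.
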